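(* Let $\mathbb{F}$ be a field of characteristic $0$ and let $\mathfrak{witt}$ be the Witt algebra over $\mathbb{F}$, with basis $(\ell_n)_{n\in\mathbb{Z}}$. Then: (a) The formula $$\omega_{\mathfrak{vir}}(\ell_m,\ell_n)=\frac{m^3-m}{12}\,\delta_{m,-n}\qquad (m,n\in\mathbb{Z}),$$ extended bilinearly, defines a 2-cocycle $\omega_{\mathfrak{vir}}\in Z^2(\mathfrak{witt};\mathbb{F})$ of $\mathfrak{witt}$ with coefficients in $\mathbb{F}$. (b) The cohomology class $[\omega_{\mathfrak{vir}}]\in H^2(\mathfrak{witt};\mathbb{F})$ is nonzero. (c) The cohomology group $H^2(\mathfrak{witt};\mathbb{F})$ is one-dimensional and generated by $[\omega_{\mathfrak{vir}}]$, i.e. $H^2(\mathfrak{witt};\mathbb{F})=\mathrm{span}_{\mathbb{F}}\{[\omega_{\mathfrak{vir}}]\}$.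
   Context: The Witt algebra $\mathfrak{witt}$ over $\mathbb{F}$ is the Lie algebra with basis $(\ell_n)_{n\in\mathbb{Z}}$ and Lie bracket $[\ell_m,\ell_n]=(m-n)\ell_{m+n}$. Let $\mathfrak{g}$ be a Lie algebra over $\mathbb{F}$ and $\mathfrak{a}$ an abelian Lie algebra (i.e. a vector space over $\mathbb{F}$ with zero bracket; here $\mathfrak{a}=\mathbb{F}$). A 2-cocycle of $\mathfrak{g}$ with coefficients in $\mathfrak{a}$ is a bilinear antisymmetric map $\omega:\mathfrak{g}\times\mathfrak{g}\to\mathfrak{a}$ satisfying $\omega(X,[Y,Z])=\omega([X,Y],Z)+\omega(Y,[X,Z])$ for all $X,Y,Z\in\mathfrak{g}$. The vector space of 2-cocycles is $Z^2(\mathfrak{g};\mathfrak{a})$. A 1-cochain is a linear map $\beta:\mathfrak{g}\to\mathfrak{a}$; the vector space of 1-cochains is $C^1(\mathfrak{g};\mathfrak{a})$. For $\beta\in C^1(\mathfrak{g};\mathfrak{a})$ set $\partial\beta(X,Y)=\beta([X,Y])$, which is a 2-cocycle. The range of $\partial:C^1(\mathfrak{g};\mathfrak{a})\to Z^2(\mathfrak{g};\mathfrak{a})$ is denoted $B^2(\mathfrak{g};\mathfrak{a})$ (2-coboundaries), and $H^2(\mathfrak{g};\mathfrak{a})=Z^2(\mathfrak{g};\mathfrak{a})/B^2(\mathfrak{g};\mathfrak{a})$. The class of $\omega\in Z^2(\mathfrak{g};\mathfrak{a})$ in the quotient is denoted $[\omega]$. $\delta$ is the Kronecker delta. *)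

(* Defs.v *)
From HB Require Import structures.
From mathcomp Require Import all_boot all_order all_algebra.
From mathcomp Require Import ring.
From mathcomp Require Import generic_quotient ring_quotient.
From mathcomp Require Import boolp classical_sets functions.
From mathcomp Require Import finmap monalg.

Set Implicit Arguments.
Unset Strict Implicit.
Unset Printing Implicit Defensive.

Import GRing.Theory.
Local Open Scope ring_scope.

HB.mixin Record Lmodule_isLie (F : fieldType) (g : Type)
    of GRing.Lmodule F g := {
  lie : g -> g -> g;
  lie_linearl : forall y : g, linear (fun x => lie x y);
  lie_linearr : forall x : g, linear (lie x);
  liexx : forall x : g, lie x x = 0;
  lie_jacobi : forall x y z : g,
    lie x (lie y z) + lie y (lie z x) + lie z (lie x y) = 0
}.

#[short(type="lieAlgType")]
HB.structure Definition LieAlg (F : fieldType) :=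
  {g of GRing.Lmodule F g & Lmodule_isLie F g}.

Section Cohomology.

(* The abelian Lie algebra of coefficients is just its underlying vector
   space a. *)
Variables (F : fieldType) (g : lieAlgType F) (a : lmodType F).

Record is_cocycle (w : g -> g -> a) : Prop := IsCocycle {
  cocycle_linearl : forall y, linear (fun x => w x y);
  cocycle_linearr : forall x, linear (w x);
  cocycle_antisym : forall x y, w x y = - w y x;
  cocycle_lie : forall x y z, w x (lie y z) = w (lie x y) z + w y (lie x z)
}.

Definition cocycle_pred : {pred g -> g -> a} := fun w => `[< is_cocycle w >].

Lemma cocycle_submod_closed : submod_closed cocycle_pred.
Proof.
split=> [|c u v /asboolP[ul ur ua uj] /asboolP[vl vr va vj]]; apply/asboolP.
  have z x y : (0 : g -> g -> a) x y = 0 by [].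
  split=> [y k u v|x k u v|x y|x y t]; rewrite !z ?oppr0 ?scaler0 ?addr0 //.
have E x y : (c *: u + v) x y = c *: u x y + v x y by [].
have S (k : F) (p q r s : a) :
    c *: (k *: p + q) + (k *: r + s) = k *: (c *: p + r) + (c *: q + s).
  by rewrite !scalerDr !scalerA mulrC addrACA.
split.
- by move=> y k x x'; rewrite !E ul vl S.
- by move=> x k y y'; rewrite !E ur vr S.
- by move=> x y; rewrite !E ua va scalerN opprD.
- by move=> x y z; rewrite !E uj vj scalerDr addrACA.
Qed.

HB.instance Definition _ :=
  GRing.isSubmodClosed.Build F (g -> g -> a) cocycle_pred cocycle_submod_closed.

Record Z2 : Type := MkZ2 {
  cocycle_fun :> g -> g -> a;
  cocycle_funP : cocycle_fun \in cocycle_pred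
}.

HB.instance Definition _ := [isSub for cocycle_fun].
HB.instance Definition _ := [Choice of Z2 by <:].
HB.instance Definition _ := [SubChoice_isSubLmodule of Z2 by <:].

Lemma Z2P (w : Z2) : is_cocycle w.
Proof. by apply/asboolP; exact: (cocycle_funP w). Qed.

Lemma Z2_eqP (u v : Z2) : (forall x y, u x y = v x y) -> u = v.
Proof. by move=> uv; apply: val_inj; apply/funext=> x; apply/funext=> y. Qed.

(* 1-cochains are elements of {linear g -> a}. *)
Definition coboundary_fun (b : {linear g -> a}) : g -> g -> a :=
  fun x y => b (lie x y).

Lemma lieNC (x y : g) : lie x y = - lie y x.
Proof.
apply/eqP; rewrite -addr_eq0; apply/eqP.
have Dl u v z : lie (u + v) z = lie u z + lie v z :> g.
  by have := lie_linearl z 1 u v; rewrite !scale1r.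
have Dr u v z : lie z (u + v) = lie z u + lie z v :> g.
  by have := lie_linearr z 1 u v; rewrite !scale1r.
by have := liexx (x + y); rewrite Dl !Dr !liexx add0r addr0.
Qed.

Lemma lieN (x y : g) : lie x (- y) = - lie x y.
Proof.
pose fL := GRing.isLinear.Build F g g _ (lie x) (lie_linearr x).
exact: (linearN (HB.pack_for {linear g -> g} (lie x) fL)).
Qed.

Lemma coboundary_is_cocycle b : coboundary_fun b \in cocycle_pred.
Proof.
rewrite /coboundary_fun; apply/asboolP; split.
- by move=> y k x x'; rewrite lie_linearl linearP.
- by move=> x k y y'; rewrite lie_linearr linearP.
- by move=> x y; rewrite lieNC linearN.
- move=> x y z; rewrite -linearD; congr (b _).
  have := lie_jacobi x y z; rewrite [lie z x]lieNC lieN [lie z (lie x y)]lieNC.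
  by move/eqP; rewrite -addrA -opprD subr_eq0 addrC => /eqP.
Qed.

Definition coboundary (b : {linear g -> a}) : Z2 := MkZ2 (coboundary_is_cocycle b).

Definition B2 : {pred Z2} := fun w => `[< exists b, w = coboundary b >].

Lemma B2_submod_closed : submod_closed B2.
Proof.
split=> [|c _ _ /asboolP[b ->] /asboolP[b' ->]]; apply/asboolP.
  by exists \0; apply: Z2_eqP.
by exists (c \*: b \+ b'); apply: Z2_eqP.
Qed.

HB.instance Definition _ := GRing.isSubmodClosed.Build F Z2 B2 B2_submod_closed.
HB.instance Definition _ := GRing.isZmodClosed.Build Z2 B2
  (GRing.submod_closedB B2_submod_closed).

Definition H2 : Type := Quotient.quot B2.
HB.instance Definition _ := GRing.Zmodule.on H2.
HB.instance Definition _ := EqQuotient.on H2.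

Definition coh_class (w : Z2) : H2 := (\pi_(Quotient.quot B2) w)%qT.

Lemma coh_class_surj (c : H2) : exists w, c = coh_class w.
Proof. by exists (repr c); rewrite /coh_class reprK. Qed.

Lemma coh_class_eq (u v : Z2) : coh_class u = coh_class v <-> u - v \in B2.
Proof.
rewrite -[u - v \in B2]/(u - v \in (B2 : zmodClosed Z2)) Quotient.idealrBE.
by split=> [/eqP//|/eqP].
Qed.

Lemma coh_classD : {morph coh_class : u v / u + v}.
Proof. by move=> u v; exact: (@Quotient.pi_add _ B2). Qed.

Definition H2_scale (k : F) (c : H2) : H2 := coh_class (k *: repr c).

Lemma H2_scaleE k w : H2_scale k (coh_class w) = coh_class (k *: w).
Proof.
apply/coh_class_eq; rewrite -scalerBr rpredZ //; apply/coh_class_eq.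
by rewrite /coh_class reprK.
Qed.

Lemma H2_scaleA j k c : H2_scale j (H2_scale k c) = H2_scale (j * k) c.
Proof. by have [w ->] := coh_class_surj c; rewrite !H2_scaleE scalerA. Qed.

Lemma H2_scale1 : left_id 1 H2_scale.
Proof. by move=> c; have [w ->] := coh_class_surj c; rewrite H2_scaleE scale1r. Qed.

Lemma H2_scaleDr : right_distributive H2_scale +%R.
Proof.
move=> k c d; have [u ->] := coh_class_surj c; have [v ->] := coh_class_surj d.
by rewrite -coh_classD !H2_scaleE scalerDr coh_classD.
Qed.

Lemma H2_scaleDl c : {morph H2_scale^~ c : j k / j + k}.
Proof.
move=> j k; have [w ->] := coh_class_surj c.
by rewrite !H2_scaleE scalerDl coh_classD.
Qed.

HB.instance Definition _ := GRing.Zmodule_isLmodule.Build F H2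
  H2_scaleA H2_scale1 H2_scaleDr H2_scaleDl.

Lemma coh_class_linear : linear coh_class.
Proof. by move=> k u v; rewrite coh_classD -H2_scaleE. Qed.

HB.instance Definition _ :=
  GRing.isLinear.Build F Z2 H2 _ coh_class coh_class_linear.

Lemma coh_class_eq0 (w : Z2) :
  coh_class w = 0 <-> exists b, w = coboundary b.
Proof.
rewrite -(linear0 coh_class) coh_class_eq subr0.
by split=> [/asboolP|?]; last exact/asboolP.
Qed.

End Cohomology.

Section Witt.

Variable F : fieldType.

(* The free F-module on the index set int: finitely supported families of
   coefficients, with basis the indicators << n >>. *)
Definition witt : Type := {malg F[int]}.
HB.instance Definition _ := GRing.Lmodule.on witt.

Definition ell (n : int) : witt := << n >>.

(* The bilinear extension of b, a function of pairs of basis indices. *)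
Definition bilin_ext (V : lmodType F) (b : int -> int -> V) (x y : witt) : V :=
  \sum_(m <- msupp x) \sum_(n <- msupp y) (x@_m * y@_n) *: b m n.

Lemma bilin_extw (V : lmodType F) (b : int -> int -> V) (x y : witt)
    (d e : {fset int}) : (msupp x `<=` d)%fset -> (msupp y `<=` e)%fset ->
  bilin_ext b x y = \sum_(m <- d) \sum_(n <- e) (x@_m * y@_n) *: b m n.
Proof.
move=> xd ye; rewrite /bilin_ext (big_fset_incl _ xd) /=; last first.
  move=> m _ /mcoeff_outdom xm; rewrite big1 // => n _.
  by rewrite xm mul0r scale0r.
apply: eq_bigr => m _; apply: big_fset_incl => // n _ /mcoeff_outdom yn.
by rewrite yn mulr0 scale0r.
Qed.

Lemma bilin_ext_linearl (V : lmodType F) (b : int -> int -> V) y :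
  linear (fun x => bilin_ext b x y).
Proof.
move=> k x x'; pose d := (msupp x `|` msupp x' `|` msupp (k *: x + x'))%fset.
have [dx dx' ds] : [/\ msupp x `<=` d, msupp x' `<=` d
                     & msupp (k *: x + x') `<=` d]%fset.
  by split; apply/fsubsetP=> i ix; rewrite !in_fsetU ix ?orbT.
rewrite !(@bilin_extw _ b _ y d (msupp y)) // scaler_sumr -big_split /=.
apply: eq_bigr => m _; rewrite scaler_sumr -big_split /=.
apply: eq_bigr => n _; rewrite mcoeffD mcoeffZ scalerA -scalerDl.
by rewrite mulrDl mulrA.
Qed.

Lemma bilin_ext_linearr (V : lmodType F) (b : int -> int -> V) x :
  linear (bilin_ext b x).
Proof.
move=> k y y'; pose d := (msupp y `|` msupp y' `|` msupp (k *: y + y'))%fset.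
have [dy dy' ds] : [/\ msupp y `<=` d, msupp y' `<=` d
                     & msupp (k *: y + y') `<=` d]%fset.
  by split; apply/fsubsetP=> i ix; rewrite !in_fsetU ix ?orbT.
rewrite !(@bilin_extw _ b x _ (msupp x) d) // scaler_sumr -big_split /=.
apply: eq_bigr => m _; rewrite scaler_sumr -big_split /=.
apply: eq_bigr => n _; rewrite mcoeffD mcoeffZ scalerA -scalerDl.
by rewrite mulrDr mulrCA.
Qed.

Lemma bilin_extE (V : lmodType F) (b : int -> int -> V) m n :
  bilin_ext b (ell m) (ell n) = b m n.
Proof.
rewrite (@bilin_extw _ b _ _ [fset m]%fset [fset n]%fset) ?msuppU_le //.
by rewrite !big_seq_fset1 !mcoeffUU mulr1 scale1r.
Qed.

Lemma witt_sumE (x : witt) : x = \sum_(n <- msupp x) x@_n *: ell n.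
Proof.
rewrite {1}[x](monalgE x); apply: eq_bigr => n _; apply/malgP=> k.
by rewrite mcoeffZ !mcoeffU; case: eqP; rewrite ?mulr1 ?mulr0.
Qed.

Lemma witt_lin_eq (V : lmodType F) (f h : witt -> V) : linear f -> linear h ->
  (forall n, f (ell n) = h (ell n)) -> forall x, f x = h x.
Proof.
move=> lf lh fh x.
pose fL : {linear witt -> V} :=
  HB.pack_for {linear witt -> V} f (GRing.isLinear.Build F witt V _ f lf).
pose hL : {linear witt -> V} :=
  HB.pack_for {linear witt -> V} h (GRing.isLinear.Build F witt V _ h lh).
rewrite -[f x]/(fL x) -[h x]/(hL x) [x]witt_sumE !linear_sum.
by apply: eq_bigr => n _; rewrite !linearZ /= fh.
Qed.

Definition witt_lie : witt -> witt -> witt :=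
  bilin_ext (fun m n => (m - n)%:~R *: ell (m + n)).

Lemma witt_lie_linearl y : linear (fun x => witt_lie x y).
Proof. exact: bilin_ext_linearl. Qed.

Lemma witt_lie_linearr x : linear (witt_lie x).
Proof. exact: bilin_ext_linearr. Qed.

Lemma witt_lieE m n :
  witt_lie (ell m) (ell n) = (m - n)%:~R *: ell (m + n).
Proof. exact: bilin_extE. Qed.

HB.instance Definition _ x :=
  GRing.isLinear.Build F witt witt _ (witt_lie x) (witt_lie_linearr x).

Lemma witt_lieC x y : witt_lie x y = - witt_lie y x.
Proof.
move: x; apply: witt_lin_eq => [||m].
- exact: witt_lie_linearl.
- by move=> k x x'; rewrite linearP scalerN opprD.
move: y; apply: witt_lin_eq => [||n].
- exact: witt_lie_linearr.
- by move=> k x x'; rewrite witt_lie_linearl scalerN opprD.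
by rewrite !witt_lieE -scaleNr -mulrNz opprB [n + m]addrC.
Qed.

Lemma witt_liexx x : witt_lie x x = 0.
Proof.
rewrite [x]witt_sumE; elim: (enum_fset _) => [|n s IH].
  by rewrite big_nil linear0.
rewrite big_cons; set t := \sum_(_ <- s) _ in IH *.
rewrite witt_lie_linearl !linearD /= IH addr0 linearZ /= witt_lieE subrr.
rewrite scale0r !scaler0 add0r linearZ /= [witt_lie t _]witt_lieC scalerN.
by rewrite subrr.
Qed.

Lemma scaler_sum3 (V : lmodType F) (k : F) (a b c a' b' c' : V) :
  k *: a + a' + (k *: b + b') + (k *: c + c') =
    k *: (a + b + c) + (a' + b' + c').
Proof.
by rewrite (addrACA (k *: a)) (addrACA (k *: a + k *: b)) !scalerDr.
Qed.

Lemma witt_jacobi x y z :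
  witt_lie x (witt_lie y z) + witt_lie y (witt_lie z x)
    + witt_lie z (witt_lie x y) = 0.
Proof.
move: x; apply: (@witt_lin_eq _ _ (fun=> 0)) => [||m].
- move=> k x x'; rewrite [witt_lie z (k *: x + x')]linearP.
  rewrite !(witt_lie_linearl y) (witt_lie_linearl (witt_lie y z)) !linearP /=.
  exact: scaler_sum3.
- by move=> k x x'; rewrite scaler0 addr0.
move: y; apply: (@witt_lin_eq _ _ (fun=> 0)) => [||n].
- move=> k y y'; rewrite (witt_lie_linearl z) (witt_lie_linearl (witt_lie _ _)).
  by rewrite !linearP /=; exact: scaler_sum3.
- by move=> k x x'; rewrite scaler0 addr0.
move: z; apply: (@witt_lin_eq _ _ (fun=> 0)) => [||p].
- move=> k z z'; rewrite (witt_lie_linearl (ell m)) !linearP /=.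
  rewrite (witt_lie_linearl (witt_lie _ _)).
  exact: scaler_sum3.
- by move=> k x x'; rewrite scaler0 addr0.
rewrite !witt_lieE !linearZ /= !witt_lieE !scalerA.
rewrite (_ : n + (p + m) = m + (n + p)); last by ring.
rewrite (_ : p + (m + n) = m + (n + p)); last by ring.
rewrite -!scalerDl -!rmorphM -!rmorphD /= [X in X%:~R](_ : _ = 0) ?scale0r //.
ring.
Qed.

HB.instance Definition _ := Lmodule_isLie.Build F witt
  witt_lie_linearl witt_lie_linearr witt_liexx witt_jacobi.

Lemma lie_ell (m n : int) :
  lie (ell m) (ell n) = (m - n)%:~R *: ell (m + n) :> witt.
Proof. exact: bilin_extE. Qed.

Definition omega_vir : witt -> witt -> F^o :=
  bilin_ext (fun m n : int =>
    (m%:~R ^+ 3 - m%:~R) / 12%:R * (m == - n)%:R : F^o).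

Lemma omega_vir_ell (m n : int) :
  omega_vir (ell m) (ell n)
    = (m%:~R ^+ 3 - m%:~R) / 12%:R * (m == - n)%:R :> F.
Proof. exact: (@bilin_extE F^o). Qed.

End Witt.

Arguments omega_vir F x y : clear implicits.

(* Main.v *)
Require Import Defs.
From HB Require Import structures.
From mathcomp Require Import all_boot all_order all_algebra.
From mathcomp Require Import ring.
From mathcomp Require Import boolp.

(** A cocycle w of the Witt algebra is determined by the scalars
    c(m, n) = w(l_m, l_n).  The cocycle identity with first argument l_0 reads
    (m - n) c(0, m + n) = - (m + n) c(m, n), so off the antidiagonal m + n = 0
    the cocycle is the coboundary of the 1-cochain l_k |-> - c(0, k) / k.  The
    value of the cochain at l_0 is still free, and changes c(m, -m) by a
    multiple of m.  On the antidiagonal the cocycle identity for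
    (l_1, l_m, l_(-m-1)) is a first-order recursion whose coefficient of
    c(m+1, -m-1) vanishes at m = 1 only; hence only c(1, -1) and c(2, -2) are
    free, and the value of the cochain at l_0 can be used to kill the first.

    All of this is packed in the linear functional
    vir_number w = 2 c(2, -2) - 4 c(1, -1) on cocycles.  It vanishes on
    coboundaries (vir_number_coboundary), a cocycle on which it vanishes is a
    coboundary (vir_number_eq0), and it takes the value 1 at omega_vir
    (vir_number_omega).  So it induces a linear isomorphism from H2 onto F that
    sends the class of omega_vir to 1, which gives the nonvanishing, the
    dimension and the generator together.  That omega_vir is a cocycle is a
    polynomial identity on basis vectors (bilin_ext_is_cocycle,
    omega_vir_is_cocycle). *)

Set Implicit Arguments.
Unset Strict Implicit.
Unset Printing Implicit Defensive.

Import GRing.Theory.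
Local Open Scope ring_scope.

HB.instance Definition _ (F : fieldType) (g : lieAlgType F) (a : lmodType F)
    (w : Z2 g a) (x : g) :=
  GRing.isLinear.Build F g a _ (cocycle_fun w x) (cocycle_linearr (Z2P w) x).

HB.instance Definition _ (F : fieldType) (V : lmodType F)
    (b : int -> int -> V) (x : witt F) :=
  GRing.isLinear.Build F (witt F) V _ (bilin_ext b x) (bilin_ext_linearr b x).

Section WittCocycles.

Variables (F : fieldType) (a : lmodType F).

(** Both cocycle conditions are linear in each argument, so they need only be
    tested on the basis. *)
Lemma bilin_ext_is_cocycle (b : int -> int -> a) :
  (forall m n, b m n = - b n m) ->
  (forall m n p, (n - p)%:~R *: b m (n + p) =
     (m - n)%:~R *: b (m + n) p + (m - p)%:~R *: b n (m + p)) ->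
  is_cocycle (bilin_ext b : witt F -> witt F -> a).
Proof.
move=> bC bJ.
have bl := bilin_ext_linearl b; have br := bilin_ext_linearr b.
have wC x y : bilin_ext b x y = - bilin_ext b y x.
  move: x; apply: witt_lin_eq => [//|k x x'|m].
    by rewrite br scalerN opprD.
  move: y; apply: witt_lin_eq => [//|k y y'|n].
    by rewrite bl scalerN opprD.
  by rewrite !bilin_extE.
split=> // x y z.
move: x; apply: witt_lin_eq => [//|k x x'|m].
  by rewrite !lie_linearl bl br scalerDr addrACA.
move: y; apply: witt_lin_eq => [k y y'|k y y'|n].
- by rewrite lie_linearl br.
- by rewrite lie_linearr !bl scalerDr addrACA.
move: z; apply: witt_lin_eq => [k z z'|k z z'|p].
- by rewrite lie_linearr br.
- by rewrite lie_linearr !br scalerDr addrACA.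
rewrite !lie_ell [bilin_ext b (_ *: _) _]wC !linearZ /= !bilin_extE.
by rewrite -bC bJ.
Qed.

Lemma cocycle_ell (w : Z2 (witt F) a) (m n p : int) :
  (n - p)%:~R *: w (ell F m) (ell F (n + p)) =
  (m - n)%:~R *: w (ell F (m + n)) (ell F p)
  + (m - p)%:~R *: w (ell F n) (ell F (m + p)).
Proof.
have [_ _ wC wJ] := Z2P w.
have := wJ (ell F m) (ell F n) (ell F p); rewrite !lie_ell [w (_ *: _) _]wC.
by rewrite !linearZ /= -wC.
Qed.

Lemma Z2_ell_eq (u v : Z2 (witt F) a) :
  (forall m n, u (ell F m) (ell F n) = v (ell F m) (ell F n)) -> u = v.
Proof.
move=> uv; have [ul ur _ _] := Z2P u; have [vl vr _ _] := Z2P v.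
apply: Z2_eqP => x y; move: x; apply: witt_lin_eq => // m.
by move: y; apply: witt_lin_eq.
Qed.

(** The linear map with prescribed values on the basis, obtained from a
    bilinear extension by freezing the second argument at an arbitrary basis
    vector. *)
Definition witt_form (b : int -> a) (x : witt F) : a :=
  bilin_ext (fun m _ => b m) x (ell F 0).

HB.instance Definition _ (b : int -> a) :=
  GRing.isLinear.Build F (witt F) a _ (witt_form b)
    (bilin_ext_linearl (fun m _ => b m) (ell F 0)).

Lemma witt_formE (b : int -> a) m : witt_form b (ell F m) = b m.
Proof. exact: bilin_extE. Qed.

End WittCocycles.

Lemma omega_vir_is_cocycle (F : fieldType) :
  is_cocycle (omega_vir F : witt F -> witt F -> F^o).
Proof.
apply: bilin_ext_is_cocycle => [m n|m n p].
  rewrite [n == _]eq_sym eqr_oppLR.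
  by case: eqP => [->|_]; rewrite ?mulr0 ?oppr0 //; ring.
rewrite /GRing.scale /=.
(* The three Kronecker deltas are all supported on m + n + p = 0. *)
have -> : (m == - (n + p)) = (p == - (m + n)) by apply/eqP/eqP => ->; ring.
have -> : (m + n == - p) = (p == - (m + n)) by apply/eqP/eqP => [->|->]; ring.
have -> : (n == - (m + p)) = (p == - (m + n)) by apply/eqP/eqP => ->; ring.
case: eqP => [->|_]; rewrite ?mulr0 ?addr0 //.
ring.
Qed.

Definition omega_vir_Z2 (F : fieldType) : Z2 (witt F) F^o :=
  MkZ2 (asboolT (omega_vir_is_cocycle F)).

Section VirasoroNumber.

Variable F : fieldType.
Implicit Types (w : Z2 (witt F) F^o).

(** The combination of c(1, -1) and c(2, -2) that ignores coboundaries, which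
    are linear in m on the antidiagonal; the factor 2 makes its value at
    omega_vir equal to 1. *)
Definition vir_number w : F^o :=
  2%:R * w (ell F 2) (ell F (- 2)) - 4%:R * w (ell F 1) (ell F (- 1)).

Lemma vir_number_linear : linear (vir_number : Z2 (witt F) F^o -> F^o).
Proof.
move=> k u v.
have E x y : (k *: u + v : Z2 (witt F) F^o) x y = k * u x y + v x y by [].
by rewrite /vir_number !E /GRing.scale /=; ring.
Qed.

HB.instance Definition _ :=
  GRing.isLinear.Build F (Z2 (witt F) F^o) F^o _ vir_number vir_number_linear.

Lemma vir_numberZ (k : F) w : vir_number (k *: w) = k * vir_number w.
Proof. exact: linearZ. Qed.

Lemma vir_number_coboundary b : vir_number (coboundary b) = 0.
Proof.
rewrite /vir_number /= /coboundary_fun !lie_ell !subrr !linearZ /=.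
by rewrite /GRing.scale /=; ring.
Qed.

Lemma vir_number_class u w :
  coh_class u = coh_class w -> vir_number u = vir_number w.
Proof.
move/coh_class_eq/asboolP=> [b uw]; apply/subr0_eq.
by rewrite -linearB uw; exact: vir_number_coboundary.
Qed.

Hypothesis char0 : [pchar F] =i pred0.

Let natrF_eq0 (n : nat) : (n%:R == 0 :> F) = (n == 0)%N.
Proof. by move: n; apply/pcharf0P. Qed.

Lemma intrF_eq0 (z : int) : (z%:~R == 0 :> F) = (z == 0).
Proof.
case: z => n; first by rewrite -pmulrn natrF_eq0.
by rewrite NegzE rmorphN /= oppr_eq0 -pmulrn natrF_eq0.
Qed.

Lemma vir_number_omega : vir_number (omega_vir_Z2 F) = 1.
Proof.
have n12 : (12%:R : F) != 0 by rewrite natrF_eq0.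
rewrite /vir_number /= !omega_vir_ell eqxx /=.
by field.
Qed.

(** The cocycle identity for (l_1, l_m, l_(-m-1)) gives
    (m - 1) c(m+1, -m-1) = (m + 2) c(m, -m) - (2 m + 1) c(1, -1), which
    propagates zeros upwards from m = 2; antisymmetry does the rest. *)
Lemma cocycle_diag_eq0 w :
  w (ell F 1) (ell F (- 1)) = 0 -> w (ell F 2) (ell F (- 2)) = 0 ->
  forall m, w (ell F m) (ell F (- m)) = 0.
Proof.
move=> w1 w2; have [_ _ wC _] := Z2P w.
have pos n : w (ell F n.+1%:Z) (ell F (- n.+1%:Z)) = 0.
  elim: n => [//|[//|n] IH].
  (* Here m = n + 2, so that the coefficient m - 1 = n + 1 is nonzero. *)
  have := cocycle_ell w 1 n.+2%:Z (- n.+3%:Z).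
  rewrite (_ : n.+2%:Z - n.+3%:Z = - 1); last by rewrite -!natz; ring.
  rewrite (_ : 1 + n.+2%:Z = n.+3%:Z); last by rewrite -!natz; ring.
  rewrite (_ : 1 - n.+3%:Z = - n.+2%:Z); last by rewrite -!natz; ring.
  rewrite w1 IH !scaler0 addr0 => /esym/eqP.
  rewrite scaler_eq0 intrF_eq0 => /orP[|/eqP//].
  by rewrite (_ : 1 - n.+2%:Z = - n.+1%:Z) //; rewrite -!natz; ring.
case=> [[|n]|n]; last 1 first.
- by rewrite NegzE opprK wC pos oppr0.
- have /eqP := wC (ell F 0) (ell F 0).
  rewrite oppr0 -addr_eq0 -mulr2n -scaler_nat scaler_eq0.
  by rewrite natrF_eq0 => /eqP.
- exact: pos.
Qed.

(** The basis values of a 1-cochain whose coboundary agrees with w off the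
    antidiagonal and at (l_1, l_(-1)); the latter fixes the value at l_0, as
    [l_1, l_(-1)] is twice l_0. *)
Definition vir_primitive w : int -> F^o := fun k =>
  if k == 0 then w (ell F 1) (ell F (- 1)) / 2%:R
  else - w (ell F 0) (ell F k) / k%:~R.

(** Subtracting the coboundary of vir_primitive w leaves a cocycle that vanishes
    off the antidiagonal and at (l_1, l_(-1)), hence also at (l_2, l_(-2))
    because its vir_number is still 0; then cocycle_diag_eq0 applies. *)
Lemma vir_number_eq0 w :
  vir_number w = 0 -> exists b, w = coboundary b.
Proof.
move=> w0.
pose u : Z2 (witt F) F^o := w - coboundary (witt_form (vir_primitive w)).
have n2 : (2%:R : F) != 0 by rewrite natrF_eq0.
have uE m n : u (ell F m) (ell F n) =
    w (ell F m) (ell F n) - (m - n)%:~R * vir_primitive w (m + n).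
  have -> x y : u x y = w x y - witt_form (vir_primitive w) (lie x y) by [].
  by rewrite lie_ell linearZ /= witt_formE.
have u1 : u (ell F 1) (ell F (- 1)) = 0.
  by rewrite uE /vir_primitive subrr eqxx; field.
have u2 : u (ell F 2) (ell F (- 2)) = 0.
  have := linearB vir_number w (coboundary (witt_form (vir_primitive w))).
  rewrite /= vir_number_coboundary w0 subr0 -/u /vir_number u1 mulr0 subr0.
  by move/eqP; rewrite mulf_eq0 (negPf n2) => /eqP.
exists (witt_form (vir_primitive w)).
suff u0 m n : u (ell F m) (ell F n) = 0.
  by apply/subr0_eq; apply: Z2_ell_eq => m n; exact: u0.
have [|mn0] := eqVneq (m + n) 0.
  by move/eqP; rewrite addrC addr_eq0 => /eqP->; apply: cocycle_diag_eq0.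
have mnF : ((m + n)%:~R : F) != 0 by rewrite intrF_eq0.
have prim : (m + n)%:~R * vir_primitive w (m + n)
    = - w (ell F 0) (ell F (m + n)).
  by rewrite /vir_primitive (negPf mn0) mulrC divfK.
have E := cocycle_ell w 0 m n; rewrite !add0r /GRing.scale /= in E.
rewrite uE; apply/(mulfI mnF).
by rewrite mulrBr mulr0 mulrCA prim mulrN E; ring.
Qed.

(** The difference of the two sides is represented by a cocycle in the kernel of
    vir_number. *)
Lemma coh_class_vir_number w :
  coh_class w = (vir_number w : F) *: coh_class (omega_vir_Z2 F).
Proof.
rewrite -linearZ; apply/coh_class_eq/asboolP; apply: vir_number_eq0.
by rewrite linearB /= vir_numberZ vir_number_omega mulr1 subrr.
Qed.

End VirasoroNumber.

(* The existence of omega : Z2 with underlying map omega_vir is the claim that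
   omega_vir is a 2-cocycle. *)
Theorem theorem6p2 (F : fieldType) (char0 : [pchar F] =i pred0) :
  exists omega : Z2 (witt F) F^o,
    [/\ omega = omega_vir F :> (witt F -> witt F -> F^o),
        coh_class omega <> 0,
        inhabited (Vector.axiom 1 (H2 (witt F) F^o))
      & forall c : H2 (witt F) F^o, exists k : F, c = k *: coh_class omega].
Proof.
pose omega := omega_vir_Z2 F.
have om1 : vir_number omega = 1 := vir_number_omega char0.
(* vir_number_class makes this independent of the chosen representative. *)
pose v2r (c : H2 (witt F) F^o) : 'rV[F]_1 := (vir_number (repr c) : F)%:M.
have v2rE (u : Z2 (witt F) F^o) : v2r (coh_class u) = (vir_number u : F)%:M.
  by congr _%:M; apply: vir_number_class; rewrite {1}/coh_class reprK.
exists omega; split=> //.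
- move=> om0; have /vir_number_class : coh_class omega = coh_class 0.
    by rewrite om0 linear0.
  by rewrite om1 linear0; apply/eqP; rewrite oner_eq0.
- constructor; exists v2r.
  + move=> k c d; have [u ->] := coh_class_surj c.
    have [v ->] := coh_class_surj d.
    rewrite -(linearP (@coh_class _ _ _)) !v2rE (linearP (@vir_number F)).
    by rewrite raddfD /= scale_scalar_mx.
  + exists (fun x : 'rV[F]_1 => x 0 0 *: coh_class omega) => [c|x].
      by have [u ->] := coh_class_surj c; rewrite v2rE mxE -coh_class_vir_number.
    rewrite -linearZ v2rE vir_numberZ om1 [X in X%:M]mulr1.
    by rewrite -mx11_scalar.
- by move=> c; have [u ->] := coh_class_surj c; exists (vir_number u);
  exact: coh_class_vir_number.
Qed.
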